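(* There is an absolute constant $c>0$ such that for every finite nonempty set $A$ of nonzero complex numbers, $$\left|\frac{A+A}{A+A}\right|\geq c|A|^2.$$
   Context: $\frac{A+A}{A+A}:=\left\{\frac{a+b}{c+d}: a,b,c,d\in A,\ c+d\neq 0\right\}$. *)

(* Defs.v *)
From HB Require Import structures.
From mathcomp Require Import all_boot all_order all_algebra.
Set Implicit Arguments. Unset Strict Implicit. Unset Printing Implicit Defensive.
Import Order.TTheory GRing.Theory Num.Theory.
Local Open Scope ring_scope.

Definition sumset (F : fieldType) (A : seq F) : seq F :=
  [seq a + b | a <- A, b <- A].

Definition quotset (F : fieldType) (A : seq F) : seq F :=
  undup [seq s / t | s <- sumset A, t <- [seq t <- sumset A | t != 0]].

(* Main.v *)
Require Import Defs.
From HB Require Import structures.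
From mathcomp Require Import all_boot all_order all_algebra.
From mathcomp Require Import ring.
Set Implicit Arguments. Unset Strict Implicit. Unset Printing Implicit Defensive.
Import Order.TTheory GRing.Theory Num.Theory.
Local Open Scope ring_scope.

(** Regard a pair (x, y) of elements of A as a point of slope y / x.  To each
    point p of slope z add a point q, depending only on z and on the octant
    of x, whose slope is the one nearest to z among the other slopes of points
    with abscissa in the same octant.  The slope w of p + q is
    z + (slope q - z) q_x / (p_x + q_x), and since p_x and q_x lie in a common
    octant, |w - z| is smaller than the distance from z to any such slope.  Two distinct
    slopes z, z' giving the same w would thus both be closer to w than to each
    other, which is impossible when z - w and z' - w lie in the same octant.
    Hence w together with two octants determines p, so
    |A|^2 <= 64 |(A+A)/(A+A)|. *)

Lemma size_le_fibers (T U : eqType) (K : finType) (f : T -> U) (k : T -> K)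
    (s : seq T) (t : seq U) :
  uniq s -> {in s, forall x, f x \in t} ->
  {in s &, forall x y, f x = f y -> k x = k y -> x = y} ->
  (size s <= size t * #|K|)%N.
Proof.
move=> s_uniq ft inj.
rewrite cardE -(size_allpairs pair) -(size_map (fun x => (f x, k x))).
apply: uniq_leq_size.
  by rewrite map_inj_in_uniq // => x y xs ys [fE kE]; apply: inj.
move=> _ /mapP[x xs ->]; apply: allpairs_f; first exact: ft.
by rewrite mem_enum.
Qed.

(** The order of [R] is only partial, so realness of the values supplies the comparisons. It is
    meant for norms in a closed field. *)
Lemma seq_real_argmin (R : numDomainType) (T : eqType) (f : T -> R)
    (s : seq T) :
  (forall x, f x \is Num.real) -> s != [::] ->
  exists2 x, x \in s & {in s, forall y, f x <= f y}.
Proof.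
move=> f_real; elim: s => // a [|b s] IHs _.
  by exists a; rewrite ?mem_head // => y; rewrite inE => /eqP ->.
have [//|x xs x_min] := IHs.
have [le_ax|lt_xa] := real_leP (f_real a) (f_real x).
  exists a; first exact: mem_head.
  move=> y; rewrite inE => /predU1P[-> //|/x_min]; exact: le_trans.
exists x; first by rewrite inE xs orbT.
by move=> y; rewrite inE => /predU1P[->|/x_min //]; apply: ltW.
Qed.

Lemma mulr_ge0_same_sign (R : numDomainType) (a c : R) :
  a \is Num.real -> c \is Num.real -> (0 <= a) = (0 <= c) -> 0 <= a * c.
Proof.
move=> ar cr; case: (real_ge0P ar) => [a0 /esym c0|a0 /esym].
  exact: mulr_ge0.
by case: (real_ge0P cr) => // c0 _; rewrite ltW // nmulr_rgt0.
Qed.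

(** The right side minus the left is [(a c - c^2) + (a c - d^2) + 2 b d], and the size bounds make
    [a c] at least [c^2] and [d^2]. Here [a] and [c] stand for the dominant coordinates of two
    vectors [(a, b)] and [(c, d)]. *)
Lemma sqr_dist_le (R : numDomainType) (a b c d : R) :
  a \is Num.real -> c \is Num.real -> d \is Num.real ->
  0 <= a * c -> 0 <= b * d -> `|c| <= `|a| -> `|d| <= `|c| ->
  (a - c) ^+ 2 + (b - d) ^+ 2 <= a ^+ 2 + b ^+ 2.
Proof.
move=> ar cr dr ac bd ca dc.
have c2 : c ^+ 2 <= a * c.
  by rewrite -(ger0_norm ac) -real_normK // normrM expr2 ler_wpM2r.
have d2 : d ^+ 2 <= a * c.
  apply: le_trans c2; rewrite -(real_normK dr) -(real_normK cr).
  by rewrite ler_pXn2r ?nnegrE.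
rewrite -subr_ge0.
have -> : a ^+ 2 + b ^+ 2 - ((a - c) ^+ 2 + (b - d) ^+ 2) =
  (a * c - c ^+ 2) + (a * c - d ^+ 2) + (b * d + b * d) by ring.
by apply: addr_ge0; apply: addr_ge0; rewrite ?subr_ge0.
Qed.

Section Octants.

Variable C : numClosedFieldType.
Implicit Types u v x y z : C.

Definition octant x : bool * bool * bool :=
  (0 <= 'Re x, 0 <= 'Im x, `|'Im x| <= `|'Re x|).

(** Nonzero vectors of one octant form an angle of at most 45 degrees, so in the triangle 0, [u],
    [v] the side facing it cannot be the strictly longest one. *)
Lemma octant_dist u v :
  octant u = octant v -> `|u - v| <= `|u| \/ `|u - v| <= `|v|.
Proof.
have sqr_le x y : 'Re x ^+ 2 + 'Im x ^+ 2 <= 'Re y ^+ 2 + 'Im y ^+ 2 ->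
    `|x| <= `|y|.
  by rewrite -!normC2_Re_Im ler_pXn2r ?nnegrE.
(* Both vectors have the same dominant coordinate; let [u] be the one where it is larger in absolute
   value. *)
wlog le_vu : u v / if `|'Im u| <= `|'Re u| then `|'Re v| <= `|'Re u|
                   else `|'Im v| <= `|'Im u|.
  move=> th uv; have [_ _ m_eq] := uv.
  have swap : `|v - u| <= `|v| \/ `|v - u| <= `|u| ->
      `|u - v| <= `|u| \/ `|u - v| <= `|v|.
    by rewrite (distrC v u) => -[le|le]; [right|left].
  have := th v u; have := th u v; rewrite -m_eq; case: ifP => _ thu thv.
    have [le|/ltW le] := real_leP (normr_real ('Re v)) (normr_real ('Re u)).
      exact: thu.
    by apply/swap/thv.
  have [le|/ltW le] := real_leP (normr_real ('Im v)) (normr_real ('Im u)).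
    exact: thu.
  by apply/swap/thv.
move=> [reE imE mE]; left; apply: sqr_le; rewrite !raddfB /=.
have re0 : 0 <= 'Re u * 'Re v by apply: mulr_ge0_same_sign.
have im0 : 0 <= 'Im u * 'Im v by apply: mulr_ge0_same_sign.
case: ifPn le_vu; rewrite mE => mv le_vu; first exact: sqr_dist_le.
rewrite addrC [leRHS]addrC; apply: sqr_dist_le => //.
by rewrite ltW // real_ltNge.
Qed.

(** Vectors of one octant have a nonnegative inner product, hence [|x + y|^2 >= |x|^2 + |y|^2]. *)
Lemma octant_norm_lt x y :
  x != 0 -> octant x = octant y -> `|y| < `|x + y|.
Proof.
move=> x0 [reE imE _].
have re0 : 0 <= 'Re x * 'Re y by apply: mulr_ge0_same_sign.
have im0 : 0 <= 'Im x * 'Im y by apply: mulr_ge0_same_sign.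
have x2 : 0 < `|x| ^+ 2 by rewrite exprn_gt0 // normr_gt0.
rewrite -(@ltr_pXn2r _ 2) ?nnegrE // -subr_gt0 !normC2_Re_Im !raddfD /=.
have -> : ('Re x + 'Re y) ^+ 2 + ('Im x + 'Im y) ^+ 2
    + (- 'Re y ^+ 2 - 'Im y ^+ 2) = ('Re x ^+ 2 + 'Im x ^+ 2) +
    (('Re x * 'Re y) *+ 2 + ('Im x * 'Im y) *+ 2) by ring.
by rewrite -normC2_Re_Im ltr_wpDr // addr_ge0 ?mulrn_wge0.
Qed.

End Octants.

Section NearestSlope.

Variables (C : numClosedFieldType) (A : seq C).
Hypotheses (A_uniq : uniq A) (A_neq0 : 0 \notin A).

Let points : seq (C * C) := [seq (x, y) | x <- A, y <- A].
Let slope (p : C * C) : C := p.2 / p.1.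
Let other_slopes (o : bool * bool * bool) (z : C) : seq (C * C) :=
  [seq q <- points | (octant q.1 == o) && (slope q != z)].
(** Taking the head of the list of minimisers makes the choice a function of [o] and [z] alone. The
    default 0 is harmless: the list is nonempty whenever [other_slopes o z] is. *)
Let nearest o z : C * C :=
  head 0 [seq q <- other_slopes o z |
            all (fun r => `|slope q - z| <= `|slope r - z|) (other_slopes o z)].
Let partner (p : C * C) : C * C := nearest (octant p.1) (slope p).
Let sum_slope (p : C * C) : C :=
  (p.2 + (partner p).2) / (p.1 + (partner p).1).

Let mem_neq0 x : x \in A -> x != 0.
Proof. by apply: contraTneq => ->. Qed.

Let pointsP p : reflect (p.1 \in A /\ p.2 \in A) (p \in points).
Proof.
apply: (iffP allpairsP) => [[q [q1 q2 ->]] //|[p1 p2]].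
by exists p; split=> //; case: p {p1 p2}.
Qed.

Let nearestP o z : other_slopes o z != [::] ->
  nearest o z \in other_slopes o z /\
  {in other_slopes o z, forall r, `|slope (nearest o z) - z| <= `|slope r - z|}.
Proof.
move=> /(seq_real_argmin (f := fun q => `|slope q - z|)) [].
  by move=> q; apply: normr_real.
move=> q q_in /allP q_min.
suff: nearest o z \in [seq q <- other_slopes o z |
    all (fun r => `|slope q - z| <= `|slope r - z|) (other_slopes o z)].
  by rewrite mem_filter => /andP[/allP].
rewrite /nearest; set s := filter _ _.
have : q \in s by rewrite mem_filter q_min.
by case: s => // a s _; apply: mem_head.
Qed.

Hypothesis A_gt1 : (1 < size A)%N.

Let other_slopes_neq0 p :
  p \in points -> other_slopes (octant p.1) (slope p) != [::].
Proof.
move=> /pointsP[p1 p2].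
(* Changing only the ordinate of [p] keeps the octant and changes the slope. *)
have [y yA y_neq] : exists2 y, y \in A & y != p.2.
  apply/hasP; apply: contraLR A_gt1; rewrite -all_predC -leqNgt => /allP A_p2.
  rewrite -[1%N]/(size [:: p.2]); apply: uniq_leq_size => // y /A_p2 /=.
  by rewrite negbK inE.
suff: (p.1, y) \in other_slopes (octant p.1) (slope p) by case: other_slopes.
rewrite mem_filter eqxx; apply/andP; split; last exact/pointsP.
by apply: contra_neq y_neq; apply: divIf; apply: mem_neq0.
Qed.

Let partnerP p : p \in points ->
  [/\ partner p \in points, octant (partner p).1 = octant p.1,
      slope (partner p) != slope p &
      {in points, forall r, octant r.1 = octant p.1 -> slope r != slope p ->
        `|slope (partner p) - slope p| <= `|slope r - slope p|}].
Proof.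
move=> /other_slopes_neq0/nearestP[].
rewrite mem_filter -/(partner p) => /andP[/andP[/eqP oE zE] pP p_min].
split=> // r rP rE rz; apply: p_min.
by rewrite mem_filter rE eqxx rz.
Qed.

Let partner_norm p : p \in points ->
  `|(partner p).1| < `|p.1 + (partner p).1|.
Proof.
move=> pP; have [/pointsP[q1 _] oE _ _] := partnerP pP.
by apply: octant_norm_lt; rewrite ?mem_neq0 //; case/pointsP: pP.
Qed.

Let partner_add_neq0 p : p \in points -> p.1 + (partner p).1 != 0.
Proof.
by move=> /partner_norm pq; rewrite -normr_gt0 (le_lt_trans _ pq).
Qed.

Let sum_slopeE p : p \in points ->
  sum_slope p - slope p =
  (slope (partner p) - slope p) * ((partner p).1 / (p.1 + (partner p).1)).
Proof.
move=> pP; have [/pointsP[/mem_neq0 q0 _] _ _ _] := partnerP pP.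
have pq0 := partner_add_neq0 pP.
case/pointsP: (pP) => /mem_neq0 p0 _.
by rewrite /sum_slope /slope; field; rewrite p0 pq0 q0.
Qed.

Let sum_slope_lt p r : p \in points -> r \in points ->
  octant r.1 = octant p.1 -> slope r != slope p ->
  `|slope p - sum_slope p| < `|slope r - slope p|.
Proof.
move=> pP rP rE rz; have [_ _ zE p_min] := partnerP pP.
apply: lt_le_trans (p_min r rP rE rz).
rewrite distrC sum_slopeE // normrM gtr_pMr ?normr_gt0 ?subr_eq0 //.
rewrite normf_div ltr_pdivrMr ?mul1r ?partner_norm //.
by rewrite normr_gt0 partner_add_neq0.
Qed.

Let sum_slope_quotset p : p \in points -> sum_slope p \in quotset A.
Proof.
move=> pP; have [/pointsP[q1 q2] _ _ _] := partnerP pP.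
case/pointsP: (pP) => p1 p2.
rewrite mem_undup; apply: allpairs_f; first exact: allpairs_f.
by rewrite mem_filter partner_add_neq0 //=; apply: allpairs_f.
Qed.

Let sum_slope_inj : {in points &, forall p r, sum_slope p = sum_slope r ->
  (octant p.1, octant (slope p - sum_slope p)) =
  (octant r.1, octant (slope r - sum_slope r)) -> p = r}.
Proof.
move=> p r pP rP wE kE.
have oE : octant p.1 = octant r.1 := congr1 fst kE.
have dE : octant (slope p - sum_slope p) = octant (slope r - sum_slope r).
  exact: (congr1 snd kE).
have zE : slope p = slope r.
  have [//|z_neq] := eqVneq (slope p) (slope r).
  have lt_p : `|slope p - sum_slope p| < `|slope p - slope r|.
    by rewrite [ltRHS]distrC sum_slope_lt // eq_sym.
  have lt_r : `|slope r - sum_slope r| < `|slope p - slope r|.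
    exact: sum_slope_lt.
  have := octant_dist dE.
  (* The common value of [sum_slope] cancels in the difference, leaving [slope p - slope r]. *)
  rewrite {1 3}wE opprB addrA subrK.
  by case=> [/(lt_le_trans lt_p)|/(lt_le_trans lt_r)]; rewrite ltxx.
have qE : partner p = partner r by rewrite /partner oE zE.
have [/pointsP[/mem_neq0 q0 _] _ qz _] := partnerP pP.
have pq0 := partner_add_neq0 pP; have rq0 := partner_add_neq0 rP.
(* With slope and partner shared, [sum_slopeE] leaves only [p.1] to vary; cancelling the nonzero
   factors gives [p.1 = r.1], and equal slopes then give [p.2 = r.2]. *)
have := sum_slopeE pP; rewrite wE zE sum_slopeE // -qE -zE.
move/(mulfI _); rewrite subr_eq0 => /(_ qz) /(mulfI q0) /invr_inj /addIr.
case/pointsP: pP rP zE => /mem_neq0 p0 _ /pointsP[/mem_neq0 r0 _].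
rewrite /slope; case: p r {qE kE oE dE wE q0 qz pq0 rq0} p0 r0 => [x y] [x' y'] /=.
by move=> x0 _ yE xE; move: yE; rewrite xE; rewrite -xE in x0 * => /divIf ->.
Qed.

Lemma size_quotset_ge : (size A ^ 2 <= 64 * size (quotset A))%N.
Proof.
have points_uniq : uniq points.
  by apply: allpairs_uniq => // -[x y] [x' y'] _ _ [-> ->].
have := size_le_fibers points_uniq sum_slope_quotset sum_slope_inj.
(* The constant 64 counts the pairs of octants, 8 times 8. *)
by rewrite size_allpairs !card_prod card_bool mulnn (mulnC 64).
Qed.

End NearestSlope.

Theorem theorem4 :
  exists2 c : rat, 0 < c &
    forall (C : numClosedFieldType) (A : seq C),
      uniq A -> A != [::] -> 0 \notin A ->
      c * ((size A)%:R ^+ 2) <= (size (quotset A))%:R.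
Proof.
exists (64%:R^-1); first by rewrite invr_gt0 ltr0n.
move=> C A A_uniq A_nil A_neq0.
rewrite mulrC ler_pdivrMr // -natrX -natrM ler_nat mulnC.
have [|A_le1] := ltnP 1 (size A); first exact: size_quotset_ge.
(* A singleton admits no second slope, but its quotient set contains [(a + a) / (a + a)], which
   suffices. *)
case: A A_nil A_le1 A_neq0 {A_uniq} => [|a [|]] // _ _.
rewrite inE eq_sym => a0.
have aa0 : a + a != 0 by rewrite -mulr2n mulrn_eq0.
by rewrite /quotset /sumset /= aa0.
Qed.
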